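(* The optimal solution to the double regularized problem $$\min_{\bm{\gamma}\in\Pi}\ \langle\bm{C},\bm{\gamma}\rangle+\varepsilon\langle\bm{\gamma},\ln\bm{\gamma}\rangle+\varepsilon\langle\bm{\eta}-\bm{\gamma},\ln(\bm{\eta}-\bm{\gamma})\rangle,\qquad \Pi=\{\bm{\gamma}\in\mathbb{R}_+^{N\times N} : \bm{\gamma}\bm{1}=\bm{u},\ \bm{\gamma}^T\bm{1}=\bm{v}\},$$ is unique. Let $\bm{\gamma}_\varepsilon$ and $\bm{\gamma}^*$ be the solutions of, respectively, this double regularized problem and the capacity constrained optimal transport problem $$\min_{\bm{\gamma}\in\mathbb{R}_+^{N\times N}}\langle\bm{C},\bm{\gamma}\rangle\quad\text{s.t. } \bm{0}\preceq\bm{\gamma}\preceq\bm{\eta},\quad \bm{\gamma}\bm{1}=\bm{u},\quad \bm{\gamma}^T\bm{1}=\bm{v}.$$ Then $\bm{\gamma}_\varepsilon$ converges to $\bm{\gamma}^*$ as $\varepsilon$ goes to $0$.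
   Context: $\mathbb{R}_+$ denotes the nonnegative reals and $\bm{1}$ the all-ones vector in $\mathbb{R}^N$. $\bm{C}\in\mathbb{R}_+^{N\times N}$ is the cost matrix, $\bm{\eta}\in\mathbb{R}_+^{N\times N}$ is the given capacity upper bound matrix, $\bm{u},\bm{v}\in\mathbb{R}_+^N$ are the given marginal vectors, and $\varepsilon>0$ is the regularization parameter. The feasible region of the capacity constrained optimal transport problem is assumed non-empty. For matrices, $\bm{A}\preceq\bm{B}$ means $a_{ij}\le b_{ij}$ for all $i,j$; $\langle\bm{A},\bm{B}\rangle=\sum_{i,j}a_{ij}b_{ij}$; the logarithm of a matrix is taken entrywise, with $0\ln 0=0$. The regularized objective is defined only where the arguments of the logarithms are nonnegative, so the bounds $\bm{0}\preceq\bm{\gamma}\preceq\bm{\eta}$ are automatically satisfied in the regularized problem. *)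

(* Defs.v *)
From HB Require Import structures.
From mathcomp Require Import all_boot all_order all_algebra.
From mathcomp Require Import all_classical all_reals all_analysis.
Set Implicit Arguments.
Unset Strict Implicit.
Unset Printing Implicit Defensive.
Import Order.TTheory GRing.Theory Num.Theory.
Import numFieldNormedType.Exports.
Local Open Scope classical_set_scope.
Local Open Scope ring_scope.

Definition lemx (R : realType) (m n : nat) (A B : 'M[R]_(m, n)) : Prop :=
  forall i j, A i j <= B i j.

Definition dotmx (R : realType) (m n : nat) (A B : 'M[R]_(m, n)) : R :=
  \sum_i \sum_j A i j * B i j.

Definition minimizer (R : realType) (T : Type) (D : set T) (F : T -> R)
    (x : T) : Prop :=
  D x /\ forall y, D y -> F x <= F y.

Section CapacityConstrainedOT.
Context (R : realType) (N : nat).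
Implicit Types (C eta g : 'M[R]_N) (u v : 'cV[R]_N) (eps : R).

Definition Pi u v : set 'M[R]_N :=
  [set g | [/\ lemx 0 g, g *m const_mx 1 = u & g^T *m const_mx 1 = v]].

Definition ccot_feasible eta u v : set 'M[R]_N :=
  [set g | [/\ lemx 0 g, lemx g eta,
               g *m const_mx 1 = u & g^T *m const_mx 1 = v]].

Definition ccot_solution C eta u v g : Prop :=
  minimizer (ccot_feasible eta u v) (dotmx C) g.

(* [0 * ln 0 = 0] holds by computation in the field, whatever [ln 0] is. *)
Definition dr_objective C eta eps g : R :=
  dotmx C g + eps * dotmx g (map_mx (@ln R) g)
            + eps * dotmx (eta - g) (map_mx (@ln R) (eta - g)).

(* The library's [ln] is total, so the natural domain of [dr_objective],
   where both logarithms have nonnegative arguments, is made explicit. *)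
Definition dr_domain eta : set 'M[R]_N :=
  [set g | lemx 0 g /\ lemx 0 (eta - g)].

Definition dr_solution C eta u v eps g : Prop :=
  minimizer (Pi u v `&` dr_domain eta) (dr_objective C eta eps) g.

End CapacityConstrainedOT.

(* Main.v *)
Require Import Defs.
From HB Require Import structures.
From mathcomp Require Import all_boot all_order all_algebra.
From mathcomp Require Import all_classical all_reals all_analysis.
From mathcomp Require Import ring lra.
Import Order.TTheory GRing.Theory Num.Theory.
Import numFieldNormedType.Exports.
Local Open Scope classical_set_scope.
Local Open Scope ring_scope.

(** The entropy [x ln x] is strongly convex on every bounded interval of
    nonnegative reals, so on the capacity constrained transport polytope [D]
    the double entropy [H] satisfies a quantitative midpoint inequality
    [k |a - b|^2 <= H a + H b - 2 H ((a + b) / 2)] with [k > 0].  The cost [L]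
    is linear, so [L + eps H] satisfies it with [eps k].  Everything follows
    from this inequality and the completeness of the space of matrices; no
    compactness is used.

    Existence and uniqueness ([exists_minimizer], [minimizer_unique]): if [mu]
    is the infimum of [F = L + eps H] on [D], then [F] is at least [mu] at the
    midpoint of [a] and [b], whence
    [eps k |a - b|^2 <= (F a - mu) + (F b - mu)].  Two minimizers are
    therefore equal, and near-minimizers form a Cauchy family, whose limit is a
    minimizer because [D] is closed and [F] is continuous on it.  The continuity
    holds up to the boundary, where an entry of the plan or of the residual
    capacity vanishes, because [x ln x] tends to [0] at [0].

    Convergence ([vanishing_regularization]): as [eps] decreases, the minimizer
    [g_eps] trades entropy for cost, so [H g_eps] increases and [L g_eps]
    decreases.  For [e < d], comparing [g_e] with the minimizer [g_d] of
    [L + d H] gives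
    [d k |g_e - g_d|^2 <= L g_e - L g_d + d (H g_e - H g_d)
    <= d (H g_e - H g_d)].  The weight [d] cancels; as [H] is bounded, [H g_eps]
    converges as [eps] tends to [0], so [g_eps] is Cauchy.  Its limit minimizes
    [L] since [L g_eps <= L y + eps (H y - H g_eps)] for every [y] in [D].
    Thus the limit exists even when the transport problem has several
    solutions. *)

(** * The scalar entropy *)

Lemma ln_le_subr1 (R : realType) (t : R) : 0 < t -> ln t <= t - 1.
Proof.
move=> t_gt0; rewrite -[in ln t](subrK 1 t) addrC le_ln1Dx//.
by rewrite ltrBrDr addrC subrr.
Qed.

(** The Bregman divergence of the entropy dominates the squared Hellinger
    distance.  Taking square roots turns [ln t <= t - 1] into this sharper
    form: the bound is applied to [b / a], and [ln (b ^+ 2 / a ^+ 2)] is twice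
    [ln (b / a)]. *)
Lemma xlnx_bregman_sqrt (R : realType) (a b : R) : 0 <= a -> 0 < b ->
  (a - b) ^+ 2 <=
  a ^+ 2 * ln (a ^+ 2) - a ^+ 2 * ln (b ^+ 2) - a ^+ 2 + b ^+ 2.
Proof.
rewrite le0r => /predU1P[->|a_gt0] b_gt0.
  by rewrite expr0n/= !mul0r !sub0r sqrrN oppr0 !add0r.
rewrite !lnXn//.
have : ln b - ln a <= b / a - 1.
  by rewrite -ln_div ?posrE// ln_le_subr1// divr_gt0.
move=> /(ler_wpM2l (sqr_ge0 a)).
rewrite [a ^+ 2 * (b / a - 1)](_ : _ = a * b - a ^+ 2).
  by rewrite !mulr2n; lra.
by field; rewrite gt_eqF.
Qed.

(** The second derivative [1 / x] is at least [1 / M] on the interval; the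
    constant is half of what Taylor's formula gives.  The derivative-free
    proof factors [x - z] as a difference of squares of square roots, whose sum
    squared is at most [4 M]; the quadratic term then follows from the
    Hellinger bound. *)
Lemma xlnx_ge_tangentD (R : realType) (M x z : R) :
    0 <= x <= M -> 0 < z <= M ->
  z * ln z + (ln z + 1) * (x - z) + (4 * M)^-1 * (x - z) ^+ 2 <= x * ln x.
Proof.
move=> /andP[x_ge0 x_le] /andP[z_gt0 z_le].
have z_ge0 := ltW z_gt0.
have M_gt0 : 0 < M by exact: lt_le_trans z_le.
have [a a_ge0 xE] : exists2 a, 0 <= a & x = a ^+ 2.
  by exists (Num.sqrt x); rewrite ?sqrtr_ge0// sqr_sqrtr.
have [b b_gt0 zE] : exists2 b, 0 < b & z = b ^+ 2.
  by exists (Num.sqrt z); rewrite ?sqrtr_gt0// sqr_sqrtr.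
have := xlnx_bregman_sqrt _ _ _ a_ge0 b_gt0; rewrite -xE -zE => breg.
suff : (4 * M)^-1 * (x - z) ^+ 2 <= (a - b) ^+ 2 by nra.
rewrite ler_pdivrMl ?mulr_gt0// xE zE subr_sqr exprMn mulrC.
rewrite ler_wpM2r ?sqr_ge0//.
have := sqr_ge0 (a - b); rewrite sqrrB sqrrD -xE -zE !mulr2n; lra.
Qed.

(** Sum of the tangent inequalities at the midpoint [z] of [x] and [y]: the
    linear terms cancel.  When [z] vanishes there is no tangent, but then so do
    [x] and [y]. *)
Lemma xlnx_midpoint (R : realType) (M x y : R) :
    0 < M -> 0 <= x <= M -> 0 <= y <= M ->
  (8 * M)^-1 * (x - y) ^+ 2 <=
  x * ln x + y * ln y - 2 * (2^-1 * (x + y) * ln (2^-1 * (x + y))).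
Proof.
move=> M_gt0 xM yM; set z := 2^-1 * (x + y).
have : 0 <= z by rewrite mulr_ge0// addr_ge0//; lra.
rewrite le0r => /predU1P[z0|z_gt0].
  have [-> ->] : x = 0 /\ y = 0 by rewrite /z in z0; lra.
  by rewrite z0 !(mul0r, mulr0, subrr, expr0n, addr0).
have zM : 0 < z <= M by rewrite z_gt0/= /z; lra.
have := lerD (xlnx_ge_tangentD _ _ _ _ xM zM) (xlnx_ge_tangentD _ _ _ _ yM zM).
have -> : (8 * M)^-1 * (x - y) ^+ 2 =
   (4 * M)^-1 * (x - z) ^+ 2 + (4 * M)^-1 * (y - z) ^+ 2.
  by rewrite /z; field; rewrite gt_eqF.
have -> : y - z = - (x - z) by rewrite /z; field.
lra.
Qed.

(** With [xlnx_le], squeezes [x ln x] to [0] at [0]. *)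
Lemma xlnx_ge_sqrt (R : realType) (x : R) : 0 <= x ->
  - (2 * Num.sqrt x) <= x * ln x.
Proof.
rewrite le0r => /predU1P[->|x_gt0]; first by rewrite sqrtr0 !(mulr0, mul0r) oppr0.
set a := Num.sqrt x.
have a_gt0 : 0 < a by rewrite sqrtr_gt0.
have -> : x = a ^+ 2 by rewrite sqr_sqrtr// ltW.
have : ln a^-1 <= a^-1 - 1 by rewrite ln_le_subr1 ?invr_gt0.
rewrite lnV ?posrE// lnXn// => /(ler_wpM2l (sqr_ge0 a)).
rewrite [a ^+ 2 * (a^-1 - 1)](_ : _ = a - a ^+ 2); first by rewrite mulr2n; nra.
by field; rewrite gt_eqF.
Qed.

Lemma xlnx_le (R : realType) (x : R) : 0 <= x -> x * ln x <= x * (x - 1).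
Proof.
rewrite le0r => /predU1P[->|x_gt0]; first by rewrite !mul0r.
by rewrite ler_pM2l ?ln_le_subr1.
Qed.

(** Away from [0] this is the continuity of [ln]; at [0] the function is
    squeezed. *)
Lemma cvg_xlnx (R : realType) (T : Type) (F : set_system T)
    (FF : Filter F) (f : T -> R) (z : R) :
    (\forall t \near F, 0 <= f t) -> 0 <= z -> f t @[t --> F] --> z ->
  f t * ln (f t) @[t --> F] --> z * ln z.
Proof.
move=> f_ge0; rewrite le0r => /predU1P[->|z_gt0] fz; last first.
  by apply: cvgM => //; apply: (cvg_comp _ _ fz); exact: continuous_ln.
rewrite mul0r; apply: (@squeeze_cvgr _ _ _ _
  (fun t => - (2 * Num.sqrt (f t))) (fun t => f t * (f t - 1))).
- near=> t; have ft : 0 <= f t by near: t.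
  by rewrite xlnx_ge_sqrt// xlnx_le.
- rewrite -oppr0; apply: cvgN; rewrite -[X in _ --> X](mulr0 2).
  apply: cvgM; first exact: cvg_cst.
  rewrite -[X in _ --> X]sqrtr0; apply: (cvg_comp _ _ fz).
  exact: sqrt_continuous.
- rewrite -[X in _ --> X](mul0r (0 - 1)).
  by apply: cvgM => //; apply: cvgB => //; exact: cvg_cst.
Unshelve. all: by end_near. Qed.

(** * Squared distance and limits of matrices *)

Lemma cvg_fin_sum (R : realType) (I : finType) (T : Type) (F : set_system T)
    (FF : Filter F) (f : I -> T -> R) (l : I -> R) :
  (forall i, f i t @[t --> F] --> l i) ->
  \sum_i f i t @[t --> F] --> \sum_i l i.
Proof. by move=> fl; apply: cvg_big => //; exact: (@add_continuous R^o). Qed.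

Lemma continuous_fin_sum (R : realType) (I : finType) (T : topologicalType)
    (f : I -> T -> R) :
  (forall i, continuous (f i)) -> continuous (fun x => \sum_i f i x).
Proof.
by move=> fc x; apply: (@cvg_fin_sum _ _ _ (nbhs x)) => i; exact: fc.
Qed.

Lemma cvg_mx_coord (R : realType) (m n : nat) (T : Type) (F : set_system T)
    (FF : Filter F) (A : T -> 'M[R]_(m, n)) (A0 : 'M[R]_(m, n)) i j :
  A t @[t --> F] --> A0 -> A t i j @[t --> F] --> A0 i j.
Proof.
move=> AA0.
exact: (cvg_comp A (fun M => M i j) AA0 (@coord_continuous _ _ _ _ _ _)).
Qed.

Lemma closed_forall (T : topologicalType) (I : Type) (P : I -> set T) :
  (forall i, closed (P i)) -> closed [set x | forall i, P i x].
Proof.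
move=> Pcl; rewrite (_ : mkset _ = \bigcap_(i in setT) P i).
  by apply: closed_bigI => i _; exact: Pcl.
by apply/seteqP; split => [x Px i _|x Px i]; exact: Px.
Qed.

Definition sqnorm {R : realType} {m n : nat} (A : 'M[R]_(m, n)) : R :=
  \sum_i \sum_j A i j ^+ 2.

Lemma sqr_coord_le_sqnorm (R : realType) (m n : nat) (A : 'M[R]_(m, n)) i j :
  A i j ^+ 2 <= sqnorm A.
Proof.
rewrite /sqnorm (bigD1 i)//= (bigD1 j)//= -addrA lerDl addr_ge0//.
  by apply: sumr_ge0 => k _; exact: sqr_ge0.
by apply: sumr_ge0 => k _; apply: sumr_ge0 => l _; exact: sqr_ge0.
Qed.

Lemma sqnormN (R : realType) (m n : nat) (A : 'M[R]_(m, n)) :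
  sqnorm (- A) = sqnorm A.
Proof.
by apply: eq_bigr => i _; apply: eq_bigr => j _; rewrite mxE sqrrN.
Qed.

Lemma sqnorm0 (R : realType) (m n : nat) : sqnorm (0 : 'M[R]_(m, n)) = 0.
Proof. by apply: big1 => i _; apply: big1 => j _; rewrite mxE expr0n. Qed.

Lemma sqnorm_eq0 (R : realType) (m n : nat) (A : 'M[R]_(m, n)) :
  sqnorm A <= 0 -> A = 0.
Proof.
move=> A0; apply/matrixP => i j; rewrite mxE; apply/eqP.
rewrite -sqrf_eq0 eq_le sqr_ge0 andbT.
by rewrite (le_trans (sqr_coord_le_sqnorm _ _ _ _ i j)).
Qed.

(** Cauchy criterion in the form in which strong convexity delivers it: the
    squared distance is bounded by the sum of the two optimality gaps. *)
Lemma cvg_at_right0_sqnorm (R : realType) (m n : nat) (x : R -> 'M[R]_(m, n))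
    (psi : R -> R) :
    psi e @[e --> 0^'+] --> (0 : R) ->
    (forall e d, 0 < e -> 0 < d ->
       sqnorm (x e - x d) <= psi e + psi d) ->
  cvg (x e @[e --> 0^'+]).
Proof.
move=> psi0 xpsi; apply: cauchy_cvg; apply: cauchy_exP => r r_gt0.
have r2_gt0 : 0 < r ^+ 2 / 2 by rewrite divr_gt0// exprn_gt0.
have psi_lt : \forall e \near 0^'+, psi e < r ^+ 2 / 2.
  by apply: (cvgr_lt _ psi0).
near (0 : R)^'+ => d; exists (x d).
change (\forall e \near (0 : R)^'+, ball (x d) r (x e)).
near=> e; split => // i j.
rewrite /ball/= -(ltr_pXn2r (n := 2))// ?nnegrE ?(ltW r_gt0)//.
rewrite real_normK ?num_real//.
have -> : x d i j - x e i j = (x d - x e) i j by rewrite !mxE.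
apply: le_lt_trans (sqr_coord_le_sqnorm _ _ _ _ i j) _.
apply: le_lt_trans (xpsi _ _ _ _) _; [by near: d; exact: nbhs_right_gt|
  by near: e; exact: nbhs_right_gt|].
have : psi d < r ^+ 2 / 2 by near: d.
have : psi e < r ^+ 2 / 2 by near: e.
lra.
Unshelve. all: by end_near. Qed.

(** * Strongly midpoint-convex minimization *)

Definition midpoint {R : realType} {m n : nat} (a b : 'M[R]_(m, n)) :
  'M[R]_(m, n) := 2^-1 *: (a + b).

(** Strong convexity tested at midpoints only, which is enough for
    minimization; the modulus [0] gives plain midpoint convexity. *)
Definition strongly_midconvex {R : realType} {m n : nat}
    (D : set 'M[R]_(m, n)) (k : R) (F : 'M[R]_(m, n) -> R) : Prop :=
  forall a b, D a -> D b ->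
    k * sqnorm (a - b) <= F a + F b - 2 * F (midpoint a b).

Definition midpoint_closed {R : realType} {m n : nat} (D : set 'M[R]_(m, n)) :=
  forall a b, D a -> D b -> D (midpoint a b).

Lemma strongly_midconvexD (R : realType) (m n : nat) (D : set 'M[R]_(m, n))
    (k c1 c2 : R) (F1 F2 : 'M[R]_(m, n) -> R) : 0 <= c2 ->
    strongly_midconvex D c1 F1 -> strongly_midconvex D k F2 ->
  strongly_midconvex D (c1 + c2 * k) (fun g => F1 g + c2 * F2 g).
Proof.
move=> c2_ge0 F1c F2c a b Da Db.
have := F1c _ _ Da Db; have := ler_wpM2l c2_ge0 (F2c _ _ Da Db); lra.
Qed.

(** The value at the midpoint is at least [l], so points with nearly minimal
    values are close to each other.  Uniqueness, existence and convergence of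
    minimizers all come from this estimate. *)
Lemma near_minimizers_close (R : realType) (m n : nat)
    (D : set 'M[R]_(m, n)) (k l : R) (F : 'M[R]_(m, n) -> R) a b :
    midpoint_closed D -> strongly_midconvex D k F ->
    (forall y, D y -> l <= F y) -> D a -> D b ->
  k * sqnorm (a - b) <= (F a - l) + (F b - l).
Proof.
move=> Dmid Fc Fl Da Db.
by have := Fc _ _ Da Db; have := Fl _ (Dmid _ _ Da Db); lra.
Qed.

Lemma minimizer_unique (R : realType) (m n : nat) (D : set 'M[R]_(m, n))
    (k : R) (F : 'M[R]_(m, n) -> R) a b :
    midpoint_closed D -> 0 < k -> strongly_midconvex D k F ->
  minimizer D F a -> minimizer D F b -> a = b.
Proof.
move=> Dmid k_gt0 Fc [Da aF] [Db bF]; apply/eqP; rewrite -subr_eq0; apply/eqP.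
apply: sqnorm_eq0; rewrite -(pmulr_rle0 _ k_gt0).
have := near_minimizers_close _ _ _ _ _ _ _ _ _ Dmid Fc aF Da Db.
by have := bF _ Da; lra.
Qed.

Lemma cvg_within_at_right0 (R : realType) (m n : nat) (D : set 'M[R]_(m, n))
    (F : 'M[R]_(m, n) -> R) (x : R -> 'M[R]_(m, n)) z :
    {within D, continuous F} -> (forall e, 0 < e -> D (x e)) -> D z ->
  x e @[e --> 0^'+] --> z -> F (x e) @[e --> 0^'+] --> F z.
Proof.
move=> /subspace_continuousP Fcont xD Dz xz.
apply: (cvg_comp x F _ (Fcont _ Dz)) => A /xz.
rewrite !nbhs_simpl /= => xA; near=> e.
have e_gt0 : 0 < e by near: e; exact: nbhs_right_gt.
by have : D (x e) -> A (x e) by [near: e]; apply; exact: xD.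
Unshelve. all: by end_near. Qed.

Lemma closed_at_right0 (R : realType) (m n : nat) (D : set 'M[R]_(m, n))
    (x : R -> 'M[R]_(m, n)) z :
  closed D -> (forall e, 0 < e -> D (x e)) -> x e @[e --> 0^'+] --> z -> D z.
Proof.
move=> Dcl xD; apply: (closed_cvg _ Dcl); near=> e; apply: xD.
by near: e; exact: nbhs_right_gt.
Unshelve. all: by end_near. Qed.

(** The direct method with completeness instead of compactness: points whose
    values are within [e] of the infimum form a Cauchy family as [e] tends
    to [0]. *)
Lemma exists_minimizer (R : realType) (m n : nat) (D : set 'M[R]_(m, n))
    (k l : R) (F : 'M[R]_(m, n) -> R) :
    D !=set0 -> closed D -> midpoint_closed D -> {within D, continuous F} ->
    (forall y, D y -> l <= F y) -> 0 < k -> strongly_midconvex D k F ->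
  exists z, minimizer D F z.
Proof.
move=> D0 Dcl Dmid Fcont Fl k_gt0 Fc.
set mu := inf (F @` D).
have FDinf : has_inf (F @` D).
  split; first by case: D0 => y Dy; exists (F y), y.
  by exists l => _ [y Dy <-]; exact: Fl.
have muF y : D y -> mu <= F y.
  by move=> Dy; apply: ge_inf; [exact: FDinf.2|exists y].
(* The guard [0 < e] sits under the existential so that choice gives a total
   function of [e]. *)
have near_min e : exists z, 0 < e -> D z /\ F z < mu + e.
  have [e_gt0|] := ltP 0 e; last by exists (point : 'M[R]_(m, n)).
  by have [_ [z Dz <-] Fz] := inf_adherent e_gt0 FDinf; exists z.
have [x xP] := choice near_min.
have id0 : e @[e --> (0 : R)^'+] --> (0 : R).
  by apply: cvg_at_right_filter; exact: cvg_id.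
have xD e : 0 < e -> D (x e) by move=> /xP[].
have /cvg_ex[z xz] : cvg (x e @[e --> 0^'+]).
  apply: (cvg_at_right0_sqnorm _ _ _ _ (fun e => k^-1 * e)).
    by rewrite -[X in _ --> X](mulr0 k^-1); apply: cvgM => //; exact: cvg_cst.
  move=> e d e_gt0 d_gt0; rewrite -mulrDr ler_pdivlMl//.
  have [De Fe] := xP _ e_gt0; have [Dd Fd] := xP _ d_gt0.
  have := near_minimizers_close _ _ _ _ _ _ _ _ _ Dmid Fc muF De Dd.
  lra.
have Dz : D z := closed_at_right0 _ _ _ _ _ _ Dcl xD xz.
exists z; split => // y /muF; apply: le_trans; rewrite -[mu]addr0.
apply: (ler_cvg_to (cvg_within_at_right0 _ _ _ _ _ _ _ Fcont xD Dz xz)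
                   (cvgD (cvg_cst mu) id0)).
near=> e; have /xP[_ /ltW//] : 0 < e by near: e; exact: nbhs_right_gt.
Unshelve. all: by end_near. Qed.

(** * Vanishing regularization *)

(** Adding the two optimality inequalities cancels [L] and leaves
    [(d - e) (H y - H x) <= 0]; the cost comparison then follows from the
    optimality of [x]. *)
Lemma regularized_minimizer_monotone (R : realType) (T : Type) (D : set T)
    (L H : T -> R) (e d : R) x y : e < d ->
    minimizer D (fun g => L g + e * H g) x ->
    minimizer D (fun g => L g + d * H g) y ->
  H y <= H x /\ (0 < e -> L x <= L y).
Proof.
move=> ed [Dx xmin] [Dy ymin].
have /= xy := xmin _ Dy; have /= yx := ymin _ Dx.
have Hyx : H y <= H x by rewrite -(ler_pM2l (x := d - e)) ?subr_gt0//; lra.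
by split=> // e_gt0; nra.
Qed.

(** The monotonicity of the cost removes [L] from the strong convexity estimate
    for [L + d H], leaving a bound by the increment of [H], in which the weight
    [d] has cancelled.  It is thus uniform as the regularization vanishes. *)
Lemma vanishing_regularization (R : realType) (m n : nat)
    (D : set 'M[R]_(m, n)) (k K : R) (L H : 'M[R]_(m, n) -> R)
    (g_ : R -> 'M[R]_(m, n)) :
    closed D -> midpoint_closed D -> {within D, continuous L} ->
    strongly_midconvex D 0 L ->
    0 < k -> strongly_midconvex D k H -> (forall y, D y -> `|H y| <= K) ->
    (forall e, 0 < e -> minimizer D (fun g => L g + e * H g) (g_ e)) ->
  exists gstar, minimizer D L gstar /\ g_ e @[e --> 0^'+] --> gstar.
Proof.
move=> Dcl Dmid Lcont Lc k_gt0 Hc HK gmin.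
have gD e : 0 < e -> D (g_ e) by move=> /gmin[].
have id0 : e @[e --> (0 : R)^'+] --> (0 : R).
  by apply: cvg_at_right_filter; exact: cvg_id.
set S := sup ((H \o g_) @` `]0, +oo[).
have HS_ub : has_ubound ((H \o g_) @` `]0, +oo[).
  exists K => _ [e + <-]; rewrite /= in_itv/= andbT => /gD/HK.
  exact: le_trans (ler_norm _).
have HS : H (g_ e) @[e --> 0^'+] --> S.
  apply: (nonincreasing_at_right_cvgr (b := +oo%O)) => //= e d.
  rewrite !in_itv/= !andbT => e_gt0 d_gt0.
  rewrite le_eqVlt => /predU1P[->//|ed].
  by have [] := regularized_minimizer_monotone _ _ _ _ _ _ _ _ _ ed
    (gmin _ e_gt0) (gmin _ d_gt0).
have H_le_S e : 0 < e -> H (g_ e) <= S.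
  move=> e_gt0; apply: ub_le_sup => //.
  by exists e => //=; rewrite in_itv/= e_gt0.
have sqnorm_le e d : 0 < e -> e < d ->
    k * sqnorm (g_ e - g_ d) <= H (g_ e) - H (g_ d).
  move=> e_gt0 ed; have d_gt0 := lt_trans e_gt0 ed.
  have [_ /(_ e_gt0) Led] := regularized_minimizer_monotone _ _ _ _ _ _ _ _ _
    ed (gmin _ e_gt0) (gmin _ d_gt0).
  have Fc := strongly_midconvexD _ _ _ _ _ _ _ _ _ (ltW d_gt0) Lc Hc.
  have := near_minimizers_close _ _ _ _ _ _ _ _ _ Dmid Fc
    (gmin _ d_gt0).2 (gD _ e_gt0) (gD _ d_gt0).
  by move=> /= gap; rewrite -(ler_pM2l d_gt0); lra.
have /cvg_ex[z gz] : cvg (g_ e @[e --> 0^'+]).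
  apply: (cvg_at_right0_sqnorm _ _ _ _ (fun e => k^-1 * (S - H (g_ e)))).
    rewrite -[X in _ --> X](mulr0 k^-1) -[X in _ * X](subrr S).
    by apply: cvgM; [exact: cvg_cst|apply: cvgB => //; exact: cvg_cst].
  move=> e d e_gt0 d_gt0; rewrite -mulrDr ler_pdivlMl//.
  have He := H_le_S _ e_gt0; have Hd := H_le_S _ d_gt0.
  have [ed|de|->] := ltgtP e d.
  - by have := sqnorm_le _ _ e_gt0 ed; lra.
  - by have := sqnorm_le _ _ d_gt0 de; rewrite -sqnormN opprB; lra.
  - by rewrite subrr sqnorm0 mulr0; lra.
have Dz : D z := closed_at_right0 _ _ _ _ _ _ Dcl gD gz.
exists z; split=> //; split=> // y Dy.
have -> : L y = L y + 0 * (K + K) by rewrite mul0r addr0.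
apply: (ler_cvg_to (cvg_within_at_right0 _ _ _ _ _ _ _ Lcont gD Dz gz)
  (cvgD (cvg_cst (L y)) (cvgM id0 (cvg_cst (K + K))))).
near=> e; have e_gt0 : 0 < e by near: e; exact: nbhs_right_gt.
have [De /(_ _ Dy) /= Fe] := gmin _ e_gt0.
have : e * (H y - H (g_ e)) <= e * (K + K).
  rewrite ler_pM2l// (le_trans (ler_norm _))// (le_trans (ler_normB _ _))//.
  by rewrite lerD// HK.
change (e * (H y - H (g_ e)) <= e * (K + K) ->
        L (g_ e) <= L y + e * (K + K)); lra.
Unshelve. all: by end_near. Qed.

(** * Entropy of matrices *)

Lemma strongly_midconvex_dotmx (R : realType) (m n : nat)
    (D : set 'M[R]_(m, n)) (C : 'M[R]_(m, n)) :
  strongly_midconvex D 0 (Defs.dotmx C).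
Proof.
move=> a b _ _; rewrite mul0r subr_ge0 /Defs.dotmx mulr_sumr -big_split/=.
apply: ler_sum => i _; rewrite mulr_sumr -big_split/=.
by apply: ler_sum => j _; rewrite !mxE; lra.
Qed.

Definition negentropy {R : realType} {m n : nat} (g : 'M[R]_(m, n)) : R :=
  \sum_i \sum_j g i j * ln (g i j).

Definition box {R : realType} {m n : nat} (M : R) : set 'M[R]_(m, n) :=
  [set g | forall i j, 0 <= g i j <= M].

Lemma strongly_midconvex_negentropy (R : realType) (m n : nat) (M : R) :
  0 < M -> strongly_midconvex (box M) (8 * M)^-1 (@negentropy R m n).
Proof.
move=> M_gt0 a b aM bM; rewrite /sqnorm /negentropy !mulr_sumr.
rewrite -big_split -sumrB/=; apply: ler_sum => i _.
rewrite !mulr_sumr -big_split -sumrB/=; apply: ler_sum => j _.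
by rewrite !mxE; exact: xlnx_midpoint.
Qed.

Lemma cvg_negentropy (R : realType) (m n : nat) (T : Type) (F : set_system T)
    (FF : Filter F) (g : T -> 'M[R]_(m, n)) (g0 : 'M[R]_(m, n)) :
    (\forall t \near F, forall i j, 0 <= g t i j) ->
    (forall i j, 0 <= g0 i j) -> g t @[t --> F] --> g0 ->
  negentropy (g t) @[t --> F] --> negentropy g0.
Proof.
move=> g_ge0 g0_ge0 gg0; apply: cvg_fin_sum => i; apply: cvg_fin_sum => j.
apply: cvg_xlnx => //; last exact: cvg_mx_coord.
by apply: filterS g_ge0.
Qed.

Lemma normr_xlnx_le (R : realType) (M x : R) : 0 <= x <= M ->
  `|x * ln x| <= 2 * Num.sqrt M + M ^+ 2.
Proof.
move=> /andP[x_ge0 xM]; have M_ge0 := le_trans x_ge0 xM.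
have lo := xlnx_ge_sqrt _ _ x_ge0; have hi := xlnx_le _ _ x_ge0.
have sqrtM : Num.sqrt x <= Num.sqrt M by rewrite ler_wsqrtr.
have := sqrtr_ge0 M; rewrite ler_norml => sM; apply/andP; split; nra.
Qed.

Lemma normr_negentropy_le (R : realType) (m n : nat) (M : R)
    (g : 'M[R]_(m, n)) : box M g ->
  `|negentropy g| <= \sum_(i < m) \sum_(j < n) (2 * Num.sqrt M + M ^+ 2).
Proof.
move=> gM; apply: le_trans (ler_norm_sum _ _ _) _; apply: ler_sum => i _.
apply: le_trans (ler_norm_sum _ _ _) _; apply: ler_sum => j _.
exact: normr_xlnx_le.
Qed.

(** * The capacity constrained transport polytope *)

Section Feasible.
Context {R : realType} {N : nat}.
Implicit Types (C eta g : 'M[R]_N) (u v : 'cV[R]_N).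

(** The domain of the logarithms supplies the capacity constraint, so both
    problems are posed on the same set. *)
Lemma regularized_feasibleE eta u v :
  Pi u v `&` dr_domain eta = ccot_feasible eta u v.
Proof.
apply/seteqP; split=> g.
  move=> [[g0 gu gv] [_ geta]]; split=> // i j.
  by have := geta i j; rewrite !mxE subr_ge0.
move=> [g0 geta gu gv]; split; split=> // i j.
by rewrite !mxE subr_ge0; exact: geta.
Qed.

Lemma row_sumE (g : 'M[R]_N) (u : 'cV[R]_N) :
  g *m const_mx 1 = u <-> forall i, \sum_j g i j = u i 0.
Proof.
have gE i : (g *m const_mx 1 : 'cV[R]_N) i 0 = \sum_j g i j.
  by rewrite mxE; apply: eq_bigr => j _; rewrite mxE mulr1.
split=> [<- i|gu]; first by rewrite gE.
by apply/colP => i; rewrite gE.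
Qed.

Lemma closed_feasible eta u v : closed (ccot_feasible eta u v).
Proof.
rewrite (_ : ccot_feasible eta u v =
  [set g | forall i j, 0 <= g i j] `&` [set g | forall i j, g i j <= eta i j]
  `&` ([set g | forall i, \sum_j g i j = u i 0]
  `&` [set g | forall j, \sum_i g i j = v j 0])); last first.
  apply/seteqP; split=> g.
    move=> [g0 geta /row_sumE gu /row_sumE gv]; split; split=> //.
      by move=> i j; have := g0 i j; rewrite mxE.
    by move=> j; rewrite -gv; apply: eq_bigr => i _; rewrite mxE.
  move=> [[g0 geta] [gu gv]]; split=> //.
  - by move=> i j; rewrite mxE.
  - exact/row_sumE.
  - by apply/row_sumE => j; rewrite -gv; apply: eq_bigr => i _; rewrite mxE.
apply: closedI; apply: closedI.
- apply: closed_forall => i; apply: closed_forall => j.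
  apply: (@preimage_closed _ _ (fun g => g i j) [set x | 0 <= x]).
    by move=> g _; exact: coord_continuous.
  exact: closed_ge.
- apply: closed_forall => i; apply: closed_forall => j.
  apply: (@preimage_closed _ _ (fun g => g i j) [set x | x <= eta i j]).
    by move=> g _; exact: coord_continuous.
  exact: closed_le.
- apply: closed_forall => i.
  apply: (@preimage_closed _ _ (fun g => \sum_j g i j) [set x | x = u i 0]).
    move=> g _; apply: (continuous_fin_sum _ _ _ (fun j g => g i j)) => j.
    exact: coord_continuous.
  exact: closed_eq.
- apply: closed_forall => j.
  apply: (@preimage_closed _ _ (fun g => \sum_i g i j) [set x | x = v j 0]).
    move=> g _; apply: (continuous_fin_sum _ _ _ (fun i g => g i j)) => i.
    exact: coord_continuous.
  exact: closed_eq.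
Qed.

Lemma midpoint_closed_feasible eta u v : midpoint_closed (ccot_feasible eta u v).
Proof.
move=> a b [a0 aeta au av] [b0 beta bu bv].
have half (w : 'cV[R]_N) : 2^-1 *: (w + w) = w.
  by apply/colP => i; rewrite !mxE; lra.
split.
- by move=> i j; have := a0 i j; have := b0 i j; rewrite !mxE; lra.
- by move=> i j; have := aeta i j; have := beta i j; rewrite !mxE; lra.
- by rewrite -scalemxAl mulmxDl au bu half.
- by rewrite linearZ linearD -scalemxAl mulmxDl av bv half.
Qed.

(** Any common positive bound on the capacities would do; the sum avoids a
    maximum over a possibly empty index set, and adding [1] makes it positive
    when all capacities vanish. *)
Definition capacity_bound eta : R := 1 + \sum_i \sum_j eta i j.

Lemma capacity_bound_gt0 eta : lemx 0 eta -> 0 < capacity_bound eta.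
Proof.
move=> eta0; rewrite ltr_pwDl// sumr_ge0// => i _; rewrite sumr_ge0// => j _.
by have := eta0 i j; rewrite mxE.
Qed.

Lemma coord_le_capacity_bound eta i j :
  lemx 0 eta -> eta i j <= capacity_bound eta.
Proof.
move=> eta0; rewrite /capacity_bound (bigD1 i)//= (bigD1 j)//=.
have eta_ge0 k l : 0 <= eta k l by have := eta0 k l; rewrite mxE.
suff : 0 <= \sum_(l | l != j) eta i l + \sum_(k | k != i) \sum_l eta k l by lra.
by rewrite addr_ge0// sumr_ge0// => k _; rewrite sumr_ge0.
Qed.

Lemma feasible_box eta u v g : lemx 0 eta -> ccot_feasible eta u v g ->
  box (capacity_bound eta) g.
Proof.
move=> eta0 [g0 geta _ _] i j; have := g0 i j; rewrite mxE => -> /=.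
exact: le_trans (geta i j) (coord_le_capacity_bound _ _ _ eta0).
Qed.

Lemma residual_box eta u v g : lemx 0 eta -> ccot_feasible eta u v g ->
  box (capacity_bound eta) (eta - g).
Proof.
move=> eta0 [g0 geta _ _] i j; have := g0 i j; have := geta i j.
by have := coord_le_capacity_bound _ i j eta0; rewrite !mxE; lra.
Qed.

Definition double_negentropy eta g : R := negentropy g + negentropy (eta - g).

Lemma dr_objectiveE C eta eps g :
  dr_objective C eta eps g = Defs.dotmx C g + eps * double_negentropy eta g.
Proof.
have dotlnE A : Defs.dotmx A (map_mx (@ln R) A) = negentropy A.
  by apply: eq_bigr => i _; apply: eq_bigr => j _; rewrite mxE.
by rewrite /dr_objective !dotlnE mulrDr addrA.
Qed.

(** The plan and the residual capacity lie in the same box and have the same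
    squared distances, so each contributes [(8 M)^-1]. *)
Lemma strongly_midconvex_double_negentropy eta u v : lemx 0 eta ->
  strongly_midconvex (ccot_feasible eta u v) (4 * capacity_bound eta)^-1
    (double_negentropy eta).
Proof.
move=> eta0 a b Da Db; have M_gt0 := capacity_bound_gt0 _ eta0.
have := strongly_midconvex_negentropy _ _ _ _ M_gt0 _ _
  (feasible_box _ _ _ _ eta0 Da) (feasible_box _ _ _ _ eta0 Db).
have := strongly_midconvex_negentropy _ _ _ _ M_gt0 _ _
  (residual_box _ _ _ _ eta0 Da) (residual_box _ _ _ _ eta0 Db).
have -> : eta - a - (eta - b) = - (a - b) by apply/matrixP => i j; rewrite !mxE; lra.
have -> : midpoint (eta - a) (eta - b) = eta - midpoint a b.
  by apply/matrixP => i j; rewrite !mxE; lra.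
have -> : (4 * capacity_bound eta)^-1 =
    (8 * capacity_bound eta)^-1 + (8 * capacity_bound eta)^-1.
  by field; rewrite gt_eqF.
by rewrite sqnormN /double_negentropy; lra.
Qed.

Lemma continuous_double_negentropy eta u v :
  {within ccot_feasible eta u v, continuous (double_negentropy eta)}.
Proof.
apply/subspace_continuousP => g [g0 geta _ _].
have gcvg : A @[A --> within (ccot_feasible eta u v) (nbhs g)] --> g.
  exact: cvg_within.
apply: cvgD; apply: cvg_negentropy.
- rewrite near_withinE; apply: nearW => A [A0 _ _ _] i j.
  by have := A0 i j; rewrite mxE.
- by move=> i j; have := g0 i j; rewrite mxE.
- exact: gcvg.
- rewrite near_withinE; apply: nearW => A [_ Aeta _ _] i j.
  by have := Aeta i j; rewrite !mxE subr_ge0.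
- by move=> i j; have := geta i j; rewrite !mxE subr_ge0.
- exact: (cvgB (cvg_cst eta) gcvg).
Qed.

Lemma continuous_cost C (D : set 'M[R]_N) : {within D, continuous (Defs.dotmx C)}.
Proof.
apply: continuous_subspaceT.
apply: continuous_fin_sum => i; apply: continuous_fin_sum => j g.
apply: (@cvgM _ _ (nbhs g) _ (fun=> C i j) (fun g => g i j)).
  exact: cvg_cst.
exact: coord_continuous.
Qed.

Lemma cost_ge0 C eta u v g : lemx 0 C -> ccot_feasible eta u v g ->
  0 <= Defs.dotmx C g.
Proof.
move=> C0 [g0 _ _ _]; apply: sumr_ge0 => i _; apply: sumr_ge0 => j _.
by have := C0 i j; have := g0 i j; rewrite !mxE => ? ?; exact: mulr_ge0.
Qed.

Lemma double_negentropy_bounded eta u v : lemx 0 eta ->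
  exists K, forall g, ccot_feasible eta u v g -> `|double_negentropy eta g| <= K.
Proof.
move=> eta0; eexists => g Dg; apply: le_trans (ler_normD _ _) _.
apply: lerD; apply: normr_negentropy_le.
  exact: feasible_box eta0 Dg.
exact: residual_box eta0 Dg.
Qed.

End Feasible.

Theorem theorem2p1 (R : realType) (N : nat) (C eta : 'M[R]_N) (u v : 'cV[R]_N)
    (C_ge0 : lemx 0 C) (eta_ge0 : lemx 0 eta)
    (u_ge0 : lemx 0 u) (v_ge0 : lemx 0 v)
    (feasible : ccot_feasible eta u v !=set0) :
  (forall eps : R, 0 < eps -> exists! g, dr_solution C eta u v eps g) /\
  (forall g_ : R -> 'M[R]_N,
     (forall eps, 0 < eps -> dr_solution C eta u v eps (g_ eps)) ->
     exists gstar : 'M[R]_N,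
       ccot_solution C eta u v gstar /\ g_ eps @[eps --> 0^'+] --> gstar).
Proof.
set D := ccot_feasible eta u v; set H := double_negentropy eta.
set k := (4 * capacity_bound eta)^-1.
have k_gt0 : 0 < k by rewrite invr_gt0 mulr_gt0// capacity_bound_gt0.
have Dcl : closed D by exact: closed_feasible.
have Dmid : midpoint_closed D by exact: midpoint_closed_feasible.
have Lc : strongly_midconvex D 0 (Defs.dotmx C).
  exact: strongly_midconvex_dotmx.
have Hc : strongly_midconvex D k H.
  exact: strongly_midconvex_double_negentropy.
have Lcont : {within D, continuous (Defs.dotmx C)} by exact: continuous_cost.
have [K HK] := double_negentropy_bounded eta u v eta_ge0.
have solE eps : dr_solution C eta u v eps =
    minimizer D (fun g => Defs.dotmx C g + eps * H g).
  rewrite /dr_solution regularized_feasibleE; congr minimizer.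
  by apply/funext => g; exact: dr_objectiveE.
split=> [eps eps_gt0|g_ g_sol]; last first.
  apply: (vanishing_regularization _ _ _ D k K _ H) => // e e_gt0.
  by rewrite -solE; exact: g_sol.
have Fc := strongly_midconvexD _ _ _ _ _ _ _ _ _ (ltW eps_gt0) Lc Hc.
have epsk_gt0 : 0 < 0 + eps * k by rewrite add0r mulr_gt0.
have Fcont : {within D, continuous (fun g => Defs.dotmx C g + eps * H g)}.
  apply/subspace_continuousP => g Dg.
  have /subspace_continuousP/(_ _ Dg) Lg := Lcont.
  have /subspace_continuousP/(_ _ Dg) Hg := continuous_double_negentropy eta u v.
  by apply: cvgD => //; apply: cvgM => //; exact: cvg_cst.
have Flb y : D y -> - (eps * K) <= Defs.dotmx C y + eps * H y.
  move=> Dy; have := cost_ge0 _ _ _ _ _ C_ge0 Dy.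
  have : eps * - K <= eps * H y.
    by rewrite ler_pM2l// lerNl (le_trans _ (HK _ Dy))// -normrN ler_norm.
  lra.
have [z zmin] := exists_minimizer _ _ _ _ _ _ _ feasible Dcl Dmid Fcont Flb
  epsk_gt0 Fc.
rewrite solE; exists z; split=> // y ymin.
exact: minimizer_unique Dmid epsk_gt0 Fc zmin ymin.
Qed.
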